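(* For any finite subset $A$ of $\mathbb{R}^n$, there exist a positive integer $\ell$, $\ell$ lower idempotent symmetric forms $f_1^-,\dots,f_\ell^-$ on $\mathbb{R}^n$ and $\ell$ real numbers $c_1,\dots,c_\ell$ such that $$\mathrm{int}\Big(\bigcap_{j\in[\ell]}[f_j^-\le c_j]\Big)\subset Co^\infty(A)\subset\bigcap_{j\in[\ell]}[f_j^-\le c_j],$$ and, if the intersection $\bigcap_{j\in[\ell]}[f_j^-\le c_j]$ is topologically regular, then $$Co^\infty(A)=\bigcap_{j\in[\ell]}[f_j^-\le c_j].$$
   Context: Notation: $\mathbb{N}=\{0,1,2,\dots\}$ and $[\ell]=\{1,\dots,\ell\}$. For $p\in\mathbb{N}$ let $\varphi_p(\lambda)=\lambda^{2p+1}$, a bijection of $\mathbb{R}$, and let $\phi_p:\mathbb{R}^n\to\mathbb{R}^n$ be its componentwise version. For a finite set $A\subset\mathbb{R}^n$, $Co^p(A)=\phi_p^{-1}\big(Co(\phi_p(A))\big)$, where $Co$ is the usual convex hull (so $Co^p(\emptyset)=\emptyset$). For a sequence of sets $A^{(p)}\subset\mathbb{R}^n$, $\mathrm{Ls}_{p\to\infty}A^{(p)}$ is the set of limits of convergent sequences $x^{(p_k)}\in A^{(p_k)}$ along subsequences $(p_k)$. Define $Co^\infty(A)=\mathrm{Ls}_{p\to\infty}Co^p(A)$. For real $u,v$, $u\stackrel{-}{\smile}v$ equals $u$ if $|u|>|v|$, $\min\{u,v\}$ if $|u|=|v|$, and $v$ if $|u|<|v|$ (this operation is associative). A lower idempotent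 symmetric form is a map $f^-:\mathbb{R}^n\to\mathbb{R}$ of the form $f^-(x)=\langle a,x\rangle_\infty^-=a_1x_1\stackrel{-}{\smile}\cdots\stackrel{-}{\smile}a_nx_n$ for some $a\in\mathbb{R}^n$. $[f\le c]=\{x:f(x)\le c\}$; $\mathrm{int}$ and $\mathrm{cl}$ denote interior and closure. A closed set $E\subset\mathbb{R}^n$ is topologically regular if $E=\mathrm{cl}(\mathrm{int}(E))$. *)

(* Defs.v *)
From HB Require Import structures.
From mathcomp Require Import all_boot all_order all_algebra.
From mathcomp Require Import all_classical all_reals all_analysis.

Set Implicit Arguments.
Unset Strict Implicit.
Unset Printing Implicit Defensive.

Import Order.TTheory GRing.Theory Num.Theory.
Import numFieldNormedType.Exports.

Local Open Scope classical_set_scope.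
Local Open Scope ring_scope.

Definition phi (R : realType) (n p : nat) (x : 'rV[R]_n) : 'rV[R]_n :=
  map_mx (fun t : R => t ^+ (2 * p).+1) x.

Definition Co (R : realType) (n : nat) (S : set 'rV[R]_n) : set 'rV[R]_n :=
  smallest (@convex_set R 'rV[R]_n) S.

Definition Cop (R : realType) (n p : nat) (A : set 'rV[R]_n) : set 'rV[R]_n :=
  @phi R n p @^-1` Co (@phi R n p @` A).

(* Kuratowski-Painleve upper limit; increasing_seq means strictly increasing. *)
Definition Ls (T : topologicalType) (A : nat -> set T) : set T :=
  [set l | exists (s : nat -> nat) (x : nat -> T),
    [/\ increasing_seq s, forall k, A (s k) (x k) & x @ \oo --> l]].

Definition Coinfty (R : realType) (n : nat) (A : set 'rV[R]_n) :
    set 'rV[R]_n :=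
  Ls (fun p => Cop p A).

Definition smile (R : realType) (u v : R) : R :=
  if `|v| < `|u| then u
  else if `|u| < `|v| then v
  else Num.min u v.

(* The right-nested iteration of the associative operation smile, whose neutral
   element is 0. *)
Definition lower_form (R : realType) (n : nat) (a x : 'rV[R]_n) : R :=
  \big[@smile R/0]_(i < n) (a 0 i * x 0 i).

Definition is_lower_form (R : realType) (n : nat) (f : 'rV[R]_n -> R) : Prop :=
  exists a : 'rV[R]_n, f = lower_form a.

(* Main.v *)
Require Import Defs.
From HB Require Import structures.
From mathcomp Require Import all_boot all_order all_algebra.
From mathcomp Require Import all_classical all_reals all_analysis.
From mathcomp Require Import ring lra.

Set Implicit Arguments.
Unset Strict Implicit.
Unset Printing Implicit Defensive.

Import Order.TTheory GRing.Theory Num.Theory.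
Import numFieldNormedType.Exports.

Local Open Scope classical_set_scope.
Local Open Scope ring_scope.

(** Let [A] consist of the points of a list [s].  The
    set [Co (phi p @` A)] is a polytope, so it is the solution set of finitely
    many linear inequalities [\sum_i alpha_i y_i <= gamma].  The point is that
    these inequalities can be chosen uniformly in [p]: Fourier-Motzkin
    elimination applied to the convex combinations of the points of
    [phi p @` A] uses only ring operations and sign tests, hence its output has
    coefficients in the ring generated by the sequences
    [p |-> t ^ (2 p + 1)].  Elements of this ring are exponential sums
    [\sum_k c_k t_k ^ (2 p + 1)] with [t_k > 0]; a nonzero one is equivalent to
    its term of largest base, so its sign is eventually constant.  Therefore
    the case distinctions of the elimination stabilise, and one finite list of
    inequalities describes the polytope for all large [p]
    ([cone_polyhedral]).

    For the same reason the [(2 p + 1)]-th root of a coefficient converges, to a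
    nonzero limit unless the coefficient vanishes identically
    ([odd_expsum_root]).  Let [a] and [c] be the limits of the roots of [alpha]
    and [gamma].  These are the coefficients of the lower forms of the theorem.
    The link between powers and lower forms is [odd_pow_sum_gt]: if
    [w_i(k) -> m_i] and [b] lies strictly below the smile of the [m_i], then
    [b ^ N < \sum_i w_i(k) ^ N] for large odd [N].

    - Outer inclusion: if [x_k -> x] satisfies the inequality at stages tending
      to infinity, then [lower_form a x > c] would contradict the inequality, by
      [odd_pow_sum_gt] ([lower_form_limit_le]).
    - Inner inclusion: apply [odd_pow_sum_gt] to the opposite terms: a point with
      [- c < lower_form (- a) y] satisfies the inequality at all large stages
      ([lower_form_strict_halfspace]).  Such points form an open set, dense in
      the interior of [lower_form a <= c] when [a != 0]
      ([lower_form_strict_dense]), and finitely many dense open sets have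
      common points.  So every point of the closure of the interior of the
      intersection is approximated by points lying in [Cop p A] for all large
      [p], which places it in the upper limit.

    The inner inclusion thus holds for the closure of the interior, and equality
    follows when the intersection is regular closed. *)

(** * Odd powers *)

Section OddPowers.
Variable R : realType.
Implicit Types (x y a b C : R) (u v w : nat -> R) (e : nat -> nat).

Lemma odd_expN n x : odd n -> (- x) ^+ n = - x ^+ n.
Proof. by move=> n_odd; rewrite exprNn -signr_odd n_odd mulN1r. Qed.

Lemma ltr_odd_exp n x y : odd n -> (x ^+ n < y ^+ n) = (x < y).
Proof.
move=> n_odd; have n0 : n != 0 by case: n n_odd.
have homo : {homo (fun z : R => z ^+ n) : x y / x < y}.
  move=> {}x {}y xy; have [x0|x0] := leP 0 x; first by rewrite ltrXn2r.
  have [y0|y0] := leP 0 y.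
    by rewrite (@lt_le_trans _ _ 0) ?exprn_odd_lt0// exprn_ge0.
  by rewrite -ltrN2 -!odd_expN// ltrXn2r// ?oppr_ge0 ?ltrN2// ltW.
by rewrite (leW_mono (le_mono homo)).
Qed.

Lemma geometric_gap r r' C : 0 <= r -> r < r' ->
  \forall p \near \oo, C * r ^+ (2 * p).+1 < r' ^+ (2 * p).+1.
Proof.
move=> r0 rr'; have r'0 : 0 < r' by exact: le_lt_trans rr'.
have q1 : `|(r / r') ^+ 2| < 1.
  rewrite normrX expr_lt1// ?ger0_norm ?divr_ge0 ?normr_ge0// ?ltW//.
  by rewrite ltr_pdivrMr// mul1r.
have /cvgr_lt/(_ 1 ltr01) := cvg_geometric (C * (r / r')) q1.
apply: filterS => p /=; rewrite -exprM -mulrA -exprS expr_div_n mulrA.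
by rewrite ltr_pdivrMr ?mul1r// exprn_gt0.
Qed.

(** Strict comparison of the bases in the limit beats any constant factor, since
    the ratio of the powers decays geometrically; [v k] may have any sign because
    odd powers are increasing on the whole line. *)
Lemma odd_pow_dominates e u v a b C : e @ \oo --> \oo ->
  u @ \oo --> a -> v @ \oo --> b -> 0 < a -> b < a -> 0 < C ->
  \forall k \near \oo, C * v k ^+ (2 * e k).+1 < u k ^+ (2 * e k).+1.
Proof.
move=> eoo ua vb a0 ba C0.
have [r [r0 br ra]] : exists r, [/\ 0 < r, b < r & r < a].
  exists ((Num.max 0 b + a) / 2).
  have : 0 <= Num.max 0 b by rewrite le_max lexx.
  have : b <= Num.max 0 b by rewrite le_max lexx orbT.
  have : Num.max 0 b < a by rewrite gt_max a0 ba.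
  by move: (Num.max 0 b) => m; split; lra.
have [r' [rr' r'a]] : exists r', r < r' /\ r' < a by exists ((r + a) / 2); lra.
have gap := eoo _ (geometric_gap C (ltW r0) rr').
near=> k.
have vr : v k < r by near: k; exact: cvgr_lt vb _ br.
have ur' : r' < u k by near: k; exact: cvgr_gt ua _ r'a.
have : C * r ^+ (2 * e k).+1 < r' ^+ (2 * e k).+1 by near: k; exact: gap.
have n_odd : odd (2 * e k).+1 by rewrite /= oddM.
move=> Crr'; apply: le_lt_trans (lt_trans Crr' _); last by rewrite ltr_odd_exp.
by rewrite ler_pM2l// ltW// ltr_odd_exp.
Unshelve. all: by end_near. Qed.

End OddPowers.

(** * The smile operation and odd powers *)

Section Smile.
Variable R : realType.
Implicit Types (b : R).

(** An iterated smile is a term of maximal absolute value, and it is positive only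
    if no term is its opposite: ties are resolved towards the negative side. *)
Lemma big_smileP (I : eqType) (r : seq I) (F : I -> R) :
  let m := \big[@smile R/0]_(i <- r) F i in
  [/\ forall i, i \in r -> `|F i| <= `|m|,
      m != 0 -> exists2 i, i \in r & F i = m
    & 0 < m -> forall i, i \in r -> - m < F i].
Proof.
elim: r => [|j r [le_m ex_m gt_m]] /=; rewrite ?big_nil ?big_cons.
  by split => //; rewrite eqxx.
set m := \big[_/_]_(i <- r) _ in le_m ex_m gt_m *; set m' := smile _ _.
have [m'E|m'E] : (m' = F j /\ (`|m| < `|F j| \/ `|F j| = `|m| /\ F j <= m)) \/
    (m' = m /\ (`|F j| < `|m| \/ `|F j| = `|m| /\ m < F j)).
- rewrite /m' /smile; case: ltgtP => h; [by left; auto|by right; auto|].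
  by rewrite minEle; case: leP => h'; [left|right]; split=> //; right.
- case: m'E => -> cmp; split => [i|_|Fj0 i]; rewrite ?inE.
  + case/predU1P => [-> //|/le_m/le_trans]; apply.
    by case: cmp => [/ltW//|[-> //]].
  + by exists j; rewrite ?mem_head.
  + case/predU1P => [->|ir]; first by lra.
    case: cmp => [cmp|[cmp le_j]].
      have := le_lt_trans (le_m _ ir) cmp; rewrite (gtr0_norm Fj0) ltr_norml.
      by case/andP.
    have m0 : 0 < m by lra.
    by move: cmp; rewrite !gtr0_norm// => ->; exact: gt_m.
- case: m'E => -> cmp; split => [i|m0|m0 i]; rewrite ?inE.
  + case/predU1P => [->|/le_m//].
    by case: cmp => [/ltW//|[-> //]].
  + by have [i ir <-] := ex_m m0; exists i => //; rewrite inE ir orbT.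
  + case/predU1P => [->|ir]; last exact: gt_m.
    case: cmp => [|[_ ?]]; last by lra.
    by rewrite (gtr0_norm m0) ltr_norml => /andP[].
Qed.

(** A form of strict lower bounds in which every condition is open in the terms;
    the semicontinuity of lower forms and the comparison with sums of odd powers
    are both read off from it. *)
Lemma big_smile_gt (I : finType) (F : I -> R) b :
  b < \big[@smile R/0]_i F i <->
  (b < 0 /\ forall i, b < F i) \/
  (exists i, [/\ b < F i, 0 < F i & forall k, - F i < F k]).
Proof.
have [le_m ex_m gt_m] := big_smileP (index_enum I) F.
set m := \big[_/_]_i _ in le_m ex_m gt_m *.
have le_m' i : `|F i| <= `|m| by rewrite le_m// mem_index_enum.
split=> [bm|[[b0 bF]|[i [bi i0 iF]]]].
- have [m0|m0] := ltP 0 m.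
    right; have [i ir im] := ex_m (lt0r_neq0 m0).
    by exists i; rewrite im; split=> // k; rewrite gt_m// mem_index_enum.
  left; split=> [|i]; first exact: lt_le_trans m0.
  by have := le_m' i; rewrite (ler0_norm m0) ler_norml => /andP[]; lra.
- have [-> //|/ex_m[i _ <-//]] := eqVneq m 0.
- have /ex_m[k _ km] : m != 0.
    by rewrite -normr_gt0 (lt_le_trans _ (le_m' i))// gtr0_norm.
  have := le_m' i; have := iF k; rewrite km (gtr0_norm i0).
  by have [m0|m0] := leP 0 m; [rewrite ger0_norm|rewrite ltr0_norm]; lra.
Qed.

(** In the first case of [big_smile_gt] the negative part of every term is
    negligible against [|b| ^ N]; in the second case one positive term dominates
    [b ^ N] and all negative parts.  Since there are fewer than
    [#|I|.+1] terms, it is enough that each domination holds with the factor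
    [#|I|.+1]. *)
Lemma odd_pow_sum_gt (I : finType) (w : I -> nat -> R) (m : I -> R)
    (e : nat -> nat) b : e @ \oo --> \oo ->
  (forall i, w i @ \oo --> m i) -> b < \big[@smile R/0]_i m i ->
  \forall k \near \oo,
    b ^+ (2 * e k).+1 < \sum_i w i k ^+ (2 * e k).+1.
Proof.
move=> eoo wm /big_smile_gt; set N : R := #|I|.+1%:R.
have N0 : 0 < N by rewrite ltr0n.
have odd_e k : odd (2 * e k).+1 by rewrite /= oddM.
have wmN i : (fun k => - w i k) @ \oo --> - m i by exact: cvgN.
case=> [[b0 bm]|[i [bi i0 iF]]].
  have : forall i, \forall k \near \oo,
      N * (- w i k) ^+ (2 * e k).+1 < (- b) ^+ (2 * e k).+1.
    move=> i; apply: odd_pow_dominates (cvg_cst _) (wmN i) _ _ N0 => //.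
      by rewrite oppr_gt0.
    by rewrite ltrN2.
  move/filter_forall; apply: filterS => k dom.
  have bk0 : b ^+ (2 * e k).+1 < 0 by rewrite exprn_odd_lt0.
  have /ler_sum : forall i, true -> b ^+ (2 * e k).+1 / N <= w i k ^+ (2 * e k).+1.
    move=> i _; have := dom i; rewrite !odd_expN// mulrN ltrN2 => /ltW.
    by rewrite ler_pdivrMr// mulrC.
  move/(_ (index_enum I)); rewrite sumr_const; apply: lt_le_trans.
  rewrite -mulr_natr -mulrA -[X in X < _]mulr1 ltr_nM2l//.
  by rewrite mulrC ltr_pdivrMr// mul1r ltr_nat.
have b_dom : \forall k \near \oo,
    N * b ^+ (2 * e k).+1 < w i k ^+ (2 * e k).+1.
  by apply: odd_pow_dominates (wm i) (cvg_cst _) i0 bi N0.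
have : forall j, \forall k \near \oo,
    N * (- w j k) ^+ (2 * e k).+1 < w i k ^+ (2 * e k).+1.
  move=> j; apply: odd_pow_dominates (wm i) (wmN j) i0 _ N0 => //.
  by rewrite ltrNl.
move/filter_forall; apply: filterS2 b_dom => k bk dom.
set W := w i k ^+ _ in bk dom *; set B := b ^+ _ in bk *.
have W0 : 0 < W.
  have := dom i; rewrite odd_expN// -/W mulrN -subr_gt0 opprK.
  rewrite -[X in X + _]mul1r -mulrDl.
  by rewrite pmulr_rgt0// addr_gt0.
have /ler_sum : forall j, true ->
    (if j == i then W else 0) - W / N <= w j k ^+ (2 * e k).+1.
  move=> j _; have WN0 : 0 <= W / N by rewrite divr_ge0// ltW.
  case: eqVneq => [->|_]; first by rewrite -/W gerBl.
  have := dom j; rewrite odd_expN// mulrN sub0r => /ltW h.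
  by rewrite lerNl ler_pdivlMr// mulNr mulrC.
move/(_ (index_enum I)); apply: lt_le_trans.
rewrite sumrB -big_mkcond big_pred1_eq sumr_const -mulr_natr.
have -> : #|I|%:R = N - 1 :> R by rewrite /N -natr1 addrK.
rewrite mulrBr mulr1 divfK ?gt_eqF// opprB addrC subrK.
by rewrite ltr_pdivlMr// mulrC.
Qed.
End Smile.

(** * Odd roots *)

Section OddRoots.
Variable R : realType.

Definition odd_root (p : nat) (y : R) : R :=
  Num.sg y * `|y| `^ (2 * p).+1%:R^-1.

Lemma odd_rootK p y : odd_root p y ^+ (2 * p).+1 = y.
Proof.
rewrite /odd_root exprMn -(powR_mulrn _ (powR_ge0 _ _)) -powRrM mulVf ?pnatr_eq0//.
rewrite powRr1 ?normr_ge0// exprS exprM sqr_sg.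
have [->|y0] := eqVneq y 0; first by rewrite normr0 mulr0.
by rewrite expr1n mulr1 -numEsg.
Qed.

(** The roots of a sequence with a nonzero limit have exponents [1 / (2 p + 1)]
    tending to 0, so only the sign survives. *)
Lemma cvg_odd_root (d : nat -> R) c : c != 0 -> d @ \oo --> c ->
  (fun p => odd_root p (d p)) @ \oo --> Num.sg c.
Proof.
move=> c0 dc; have normc0 : 0 < `|c| by rewrite normr_gt0.
have normd : (fun p => `|d p|) @ \oo --> `|c| by exact: cvg_norm.
have inv0 : (fun p => (2 * p).+1%:R^-1 : R) @ \oo --> (0 : R).
  apply: (@squeeze_cvgr _ _ _ _ (fun=> 0) (@harmonic R)).
  - near=> p; rewrite invr_ge0 ler0n /= lef_pV2 ?posrE ?ltr0n// ler_nat ltnS.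
    by rewrite leq_pmull.
  - exact: cvg_cst.
  - exact: cvg_harmonic.
have exp1 : (fun p => `|d p| `^ (2 * p).+1%:R^-1) @ \oo --> (1 : R).
  have : (fun p => expR ((2 * p).+1%:R^-1 * ln `|d p|)) @ \oo --> (1 : R).
    rewrite [X in _ --> X](_ : 1 = expR (0 * ln `|c|)); last first.
      by rewrite mul0r expR0.
    apply: continuous_cvg.
      exact: continuous_expR.
    apply: cvgM => //; exact: (continuous_cvg _ (continuous_ln normc0) normd).
  apply: cvg_trans; apply: near_eq_cvg; near=> p.
  rewrite /powR gt_eqF//; near: p; exact: (cvgr_gt _ normd _ normc0).
rewrite -[X in _ --> X]mulr1; apply: cvgM => //.
apply: cvg_near_cst.
have [c_gt|c_lt] := ltP 0 c.
  near=> p; rewrite (gtr0_sg c_gt) gtr0_sg//; near: p; exact: (cvgr_gt _ dc _ c_gt).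
have {}c_lt : c < 0 by rewrite lt_neqAle c0.
near=> p; rewrite (ltr0_sg c_lt) ltr0_sg//; near: p; exact: (cvgr_lt _ dc _ c_lt).
Unshelve. all: by end_near. Qed.

End OddRoots.

(** * The ring of exponential sums *)

Section ExponentialSums.
Variable R : realType.
Implicit Types (u v : nat -> R) (s : seq (R * R)) (c t : R).

Definition esum_of s (p : nat) : R := \sum_(z <- s) z.1 * z.2 ^+ (2 * p).+1.

(** Bases are required to be positive so that two terms of maximal absolute value
    have the same base and can be merged: a negative base is replaced by its
    opposite, with the opposite coefficient. *)
Definition odd_expsum u : Prop :=
  exists2 s, all (fun z : R * R => 0 < z.2) s & u = esum_of s.

Lemma odd_expsum_cst c : odd_expsum (fun=> c).
Proof.
exists [:: (c, 1)]; first by rewrite /= ltr01.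
by apply/funext => p; rewrite /esum_of big_seq1 expr1n mulr1.
Qed.

Lemma odd_expsum_opp u : odd_expsum u -> odd_expsum (fun p => - u p).
Proof.
move=> [s s0 ->]; exists [seq (- z.1, z.2) | z <- s]; first by rewrite all_map.
apply/funext => p; rewrite /esum_of big_map -sumrN.
by under [RHS]eq_bigr do rewrite mulNr.
Qed.

Lemma odd_expsum_pow (x : R) : odd_expsum (fun p => x ^+ (2 * p).+1).
Proof.
have [x0|x0|<-] := ltrgtP 0 x.
- exists [:: (1, x)]; first by rewrite /= x0.
  by apply/funext => p; rewrite /esum_of big_seq1 mul1r.
- exists [:: (-1, - x)]; first by rewrite /= oppr_gt0 x0.
  apply/funext => p; rewrite /esum_of big_seq1 odd_expN ?mulrNN ?mul1r//.
  by rewrite /= oddM.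
- exists [::] => //; apply/funext => p.
  by rewrite /esum_of big_nil expr0n.
Qed.

Lemma odd_expsumD u v :
  odd_expsum u -> odd_expsum v -> odd_expsum (fun p => u p + v p).
Proof.
move=> [s s0 ->] [r r0 ->]; exists (s ++ r); first by rewrite all_cat s0.
by apply/funext => p; rewrite /esum_of big_cat.
Qed.

Lemma odd_expsumM u v :
  odd_expsum u -> odd_expsum v -> odd_expsum (fun p => u p * v p).
Proof.
move=> [s s0 ->] [r r0 ->].
exists [seq (x.1 * y.1, x.2 * y.2) | x : R * R <- s, y : R * R <- r].
  apply/allP => z /allpairsP[[x y] /= [xs yr ->]] /=.
  by rewrite mulr_gt0//; [exact: (allP s0)|exact: (allP r0)].
apply/funext => p; rewrite /esum_of big_allpairs_dep big_distrlr /=.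
by under eq_bigr do under eq_bigr do rewrite mulrACA -exprMn.
Qed.

Lemma odd_expsum_sum (I : Type) (r : seq I) (F : I -> nat -> R) :
  (forall i, odd_expsum (F i)) -> odd_expsum (fun p => \sum_(i <- r) F i p).
Proof.
move=> tF; elim: r => [|i r IH].
  by under eq_fun do rewrite big_nil; exact: odd_expsum_cst.
by under eq_fun do rewrite big_cons; exact: odd_expsumD.
Qed.

Lemma exists_seq_max (r : seq R) : r != [::] ->
  exists2 t, t \in r & all (fun z => z <= t) r.
Proof.
elim: r => // x [_|y r /(_ isT) [t tr tmax]] _.
  by exists x; rewrite ?mem_head /= ?lexx.
have [xt|tx] := leP x t.
  by exists t; [rewrite inE tr orbT|rewrite /= xt].
exists x; first exact: mem_head.
by rewrite /= lexx; apply: sub_all tmax => z /le_trans; apply; exact: ltW.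
Qed.

(** Merge the terms whose base is the largest one, [t].  If their coefficients
    cancel, fewer terms remain; otherwise the sum is [t ^ (2 p + 1)] times a
    sequence with a nonzero limit, and [cvg_odd_root] applies. *)
Lemma odd_expsum_rate u : odd_expsum u ->
  u = (fun=> 0) \/
  exists a (w : nat -> R), [/\ a != 0, w @ \oo --> a
    & forall p, u p = w p ^+ (2 * p).+1].
Proof.
move=> [s]; have [n] := ubnP (size s); elim: n s u => // n IH s u sn s0 uE.
have [s_nil|s_nil] := eqVneq s [::].
  by left; rewrite uE s_nil; apply/funext => p; rewrite /esum_of big_nil.
have [t /mapP[z zs tz] tmax] : exists2 t, t \in [seq x.2 | x <- s] &
    all (fun z => z <= t) [seq x.2 | x <- s].
  by apply: exists_seq_max; case: (s) s_nil.
have t0 : 0 < t by rewrite tz; exact: (allP s0).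
pose low := [seq x <- s | x.2 != t].
pose c := \sum_(x <- s | x.2 == t) x.1.
have uE' p : u p = c * t ^+ (2 * p).+1 + esum_of low p.
  rewrite uE /esum_of (bigID (fun x => x.2 == t)) /= big_filter /c mulr_suml.
  by congr (_ + _); apply: eq_bigr => x /eqP ->.
have low0 : all (fun x => 0 < x.2) low.
  by apply/allP => x; rewrite mem_filter => /andP[_ /(allP s0)].
have [c0|c0] := eqVneq c 0.
  apply: (IH low) => //; last first.
    by apply/funext => p; rewrite uE' c0 mul0r add0r.
  rewrite -ltnS (leq_trans _ sn)// ltnS size_filter.
  rewrite -(count_predC (fun x => x.2 != t) s) -addn1 leq_add2l -has_count.
  by apply/hasP; exists z => //=; rewrite tz eqxx.
right; pose d p := c + \sum_(x <- low) x.1 * (x.2 / t) ^+ (2 * p).+1.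
have uE2 p : u p = t ^+ (2 * p).+1 * d p.
  rewrite uE' mulrDr [t ^+ _ * c]mulrC; congr (_ + _).
  rewrite /esum_of mulr_sumr; apply: eq_bigr => x _.
  by rewrite expr_div_n mulrCA [_ * (_ / _)]mulrC divfK// expf_neq0// gt_eqF.
have dc : d @ \oo --> c.
  rewrite -[X in _ --> X]addr0; apply: cvgD; first exact: cvg_cst.
  have : {subset low <= low} by [].
  elim: {1 3}low => [_|x r IHr sub].
    by under eq_fun do rewrite big_nil; exact: cvg_cst.
  under eq_fun do rewrite big_cons.
  have /IHr r_to0 : {subset r <= low}.
    by move=> y yr; apply: sub; rewrite inE yr orbT.
  suff /cvgD/(_ r_to0) : (fun p => x.1 * (x.2 / t) ^+ (2 * p).+1) @ \oo --> 0.
    by rewrite addr0; exact.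
  have xlow : x \in low by apply: sub; exact: mem_head.
  have x0 : 0 < x.2 by exact: (allP low0).
  have xt : x.2 < t.
    move: xlow; rewrite mem_filter lt_neqAle => /andP[-> xs] /=.
    by apply: (allP tmax); exact: map_f.
  have q1 : `|(x.2 / t) ^+ 2| < 1.
    rewrite normrX expr_lt1// ?normr_ge0// ger0_norm ?divr_ge0// ?ltW//.
    by rewrite ltr_pdivrMr// mul1r.
  have := cvg_geometric (x.1 * (x.2 / t)) q1.
  apply: cvg_trans; apply: near_eq_cvg; near=> p.
  by rewrite /geometric /= -exprM -mulrA -exprS.
exists (t * Num.sg c), (fun p => t * odd_root p (d p)); split.
- by rewrite mulf_neq0 ?sgr_eq0// gt_eqF.
- by apply: cvgM; [exact: cvg_cst|exact: cvg_odd_root].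
- by move=> p; rewrite exprMn odd_rootK.
Unshelve. all: by end_near. Qed.

Lemma odd_expsum_root u : odd_expsum u ->
  exists a (w : nat -> R), [/\ w @ \oo --> a,
    forall p, u p = w p ^+ (2 * p).+1 & a = 0 -> u = fun=> 0].
Proof.
case/odd_expsum_rate => [->|[a [w [a0 wa uw]]]].
  by exists 0, (fun=> 0); split => // [|p]; [exact: cvg_cst|rewrite expr0n].
by exists a, w; split => // a_0; rewrite a_0 eqxx in a0.
Qed.

(** This makes the branches taken by Fourier-Motzkin elimination independent of
    [p] for large [p]. *)
Lemma odd_expsum_sg u : odd_expsum u ->
  exists sgn : R, \forall p \near \oo, Num.sg (u p) = sgn.
Proof.
case/odd_expsum_rate => [->|[a [w [a0 wa uw]]]].
  by exists 0; near=> p; rewrite sgr0.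
exists (Num.sg a); have := a0; rewrite neq_lt => /orP[a_lt|a_gt].
  near=> p; rewrite (ltr0_sg a_lt) ltr0_sg// uw exprn_odd_lt0//=; last by rewrite oddM.
  by near: p; exact: (cvgr_lt _ wa _ a_lt).
near=> p; rewrite (gtr0_sg a_gt) gtr0_sg// uw exprn_gt0//.
by near: p; exact: (cvgr_gt _ wa _ a_gt).
Unshelve. all: by end_near. Qed.

End ExponentialSums.

(** * Convex hulls of finite sets as slices of cones *)

Section Cone.
Variables (R : realType) (V : lmodType R).
Implicit Types (s : seq V) (y z : V) (h c : R).

(** The cone generated by the pairs [(a, 1)], [a] in [s].  Recording the total weight
    [h] makes the description of a convex hull homogeneous, so that each
    point of [s] contributes a single existential quantifier over a linear
    condition, ready for elimination. *)
Fixpoint cone s y h : Prop :=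
  if s is a :: s' then exists2 t, 0 <= t & cone s' (y - t *: a) (h - t)
  else y = 0 /\ h = 0.

Lemma cone_ge0 s y h : cone s y h -> 0 <= h.
Proof.
elim: s y h => [y h [_ ->//]|a s IH y h /= [t t0 /IH]].
by rewrite subr_ge0; exact: le_trans.
Qed.

Lemma cone_height0 s y : cone s y 0 -> y = 0.
Proof.
elim: s y => [y [//]|a s IH y /= [t t0 st]]; have := cone_ge0 st.
rewrite subr_ge0 => t_le0; have t_eq0 : t = 0 by apply/le_anti; rewrite t0 t_le0.
by apply: IH; rewrite t_eq0 scale0r !subr0 in st.
Qed.

Lemma cone0 s : cone s 0 0.
Proof. by elim: s => //= a s IH; exists 0; rewrite // scale0r !subr0. Qed.

Lemma coneD s y z h c : cone s y h -> cone s z c -> cone s (y + z) (h + c).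
Proof.
elim: s y z h c => [y z h c [-> ->] [-> ->]|a s IH y z h c]; first by rewrite !addr0.
move=> [t t0 st] [r r0 sr]; exists (t + r); first exact: addr_ge0.
by rewrite scalerDl !opprD (addrACA y) (addrACA h); exact: IH.
Qed.

Lemma coneZ s y h c : 0 <= c -> cone s y h -> cone s (c *: y) (c * h).
Proof.
move=> c0; elim: s y h => [y h [-> ->]|a s IH y h [t t0 st]] /=.
  by rewrite scaler0 mulr0.
exists (c * t); first exact: mulr_ge0.
by rewrite -scalerA -scalerBr -mulrBr; exact: IH.
Qed.

Lemma cone_mem s a : a \in s -> cone s a 1.
Proof.
elim: s => //= b s IH; rewrite inE => /predU1P[->|/IH sa].
  by exists 1; rewrite // scale1r !subrr; exact: cone0.
by exists 0; rewrite // scale0r !subr0.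
Qed.

(** Rescaled to height 1, a point of the cone of [a :: s] is a convex combination
    of [a], with weight [t / h], and of a rescaled point of the cone of [s]. *)
Lemma cone_sub_convex (C : set V) s y h : convex_set C -> [set` s] `<=` C ->
  cone s y h -> 0 < h -> C (h^-1 *: y).
Proof.
move=> C_convex; elim: s y h => [y h _ [_ ->]|a s IH y h sC [t t0 st] h0].
  by rewrite ltxx.
have aC : C a by apply: sC; rewrite /= mem_head.
have [ht_le0|ht_gt0] := leP (h - t) 0.
  have ht : h - t = 0 by apply/le_anti; rewrite ht_le0 (cone_ge0 st).
  move: st; rewrite ht => /cone_height0/subr0_eq ->.
  by rewrite scalerA (subr0_eq ht) mulVf ?scale1r// -(subr0_eq ht) gt_eqF.
have zC : C ((h - t)^-1 *: (y - t *: a)).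
  by apply: IH => // x xs; apply: sC; rewrite /= inE [_ \in s]xs orbT.
have lt1 : t / h <= 1 by rewrite ler_pdivrMr// mul1r -subr_ge0 ltW.
have l0 : 0 <= t / h by rewrite divr_ge0// ltW.
have := C_convex a _ (Itv01 l0 lt1) (mem_set aC) (mem_set zC).
rewrite inE; congr C; rewrite /conv /=.
have -> : unstable.onem (t / h) = (h - t) / h.
  by rewrite /unstable.onem; field; rewrite gt_eqF.
rewrite scalerA mulrAC divff ?gt_eqF// mul1r.
by rewrite [t / h]mulrC -scalerA -scalerDr addrC subrK.
Qed.

Lemma cone_convex_hull s y :
  smallest (@convex_set R V) [set` s] y <-> cone s y 1.
Proof.
split=> [|sy C [C_convex sC]]; last first.
  by have := cone_sub_convex C_convex sC sy ltr01; rewrite invr1 scale1r.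
move=> /(_ [set z | cone s z 1]); apply; split=> [u v l|a]; last exact: cone_mem.
rewrite !inE /= => su sv.
have l0 : 0 <= l%:num by [].
have l1 : 0 <= 1 - l%:num by rewrite subr_ge0.
by have := coneD (coneZ l0 su) (coneZ l1 sv); rewrite !mulr1 [_ + (1 - _)]addrC subrK.
Qed.

End Cone.

(** * Uniform Fourier-Motzkin elimination *)

Section FourierMotzkin.
Variables (R : realType) (n : nat).
Implicit Types (l : 'rV[R]_n * R) (y : 'rV[R]_n) (h t : R).

Definition slack l y h : R := \sum_i l.1 0 i * y 0 i - l.2 * h.

Lemma slack0 y h : slack 0 y h = 0.
Proof. by rewrite /slack mul0r subr0 big1// => i _; rewrite mxE mul0r. Qed.

Lemma slackB l y z h t : slack l (y - t *: z) (h - t) = slack l y h - t * slack l z 1.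
Proof.
rewrite /slack mulr1 (eq_bigr (fun i => l.1 0 i * y 0 i - t * (l.1 0 i * z 0 i))).
  by rewrite sumrB -mulr_sumr; ring.
by move=> i _; rewrite !mxE; ring.
Qed.

Lemma slack_comb k l y h b c :
  slack (b *: k - c *: l) y h = b * slack k y h - c * slack l y h.
Proof.
rewrite /slack (eq_bigr (fun i => b * (k.1 0 i * y 0 i) - c * (l.1 0 i * y 0 i))).
  by rewrite sumrB -!mulr_sumr /=; rewrite /GRing.scale /=; ring.
by move=> i _; rewrite !mxE; ring.
Qed.

(** One step of Fourier-Motzkin elimination for a nonnegative unknown [t].  The
    witness is the largest of 0 and the lower bounds imposed by the [b j > 0]. *)
Lemma exists_nonneg_multiplier (J : finType) (v b : J -> R) :
  (exists2 t, 0 <= t & forall j, v j <= t * b j) <->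
  (forall j, b j <= 0 -> v j <= 0) /\
  (forall j k, 0 < b j -> b k < 0 -> b j * v k - b k * v j <= 0).
Proof.
split=> [[t t0 vb]|[v_le0 v_pair]].
  split=> [j bj|j k bj bk]; first by rewrite (le_trans (vb j))// mulr_ge0_le0.
  rewrite subr_le0; apply: (@le_trans _ _ (b j * (t * b k))).
    by rewrite ler_pM2l.
  by rewrite mulrA [_ * b k]mulrC ler_nM2l// mulrC.
exists (\big[Num.max/0]_(j | 0 < b j) (v j / b j)) => [|k].
  exact: bigmax_ge_id.
have [bk|bk|bk] := ltrgtP (b k) 0.
- rewrite -ler_ndivlMr//; apply: bigmax_le => [|j bj].
    by rewrite nmulr_lge0 ?invr_lt0//; apply: v_le0; exact: ltW.
  rewrite ler_pdivrMr// mulrAC ler_ndivlMr//.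
  by have := v_pair j k bj bk; rewrite subr_le0 mulrC [v j * _]mulrC.
- by rewrite -ler_pdivrMr//; exact: le_bigmax_cond.
- by rewrite bk mulr0 v_le0// bk.
Qed.

Definition tame_form (l : nat -> 'rV[R]_n * R) : Prop :=
  (forall i, odd_expsum (fun p => (l p).1 0 i)) /\ odd_expsum (fun p => (l p).2).

Lemma tame_form0 : tame_form (fun=> 0).
Proof.
split=> [i|]; last exact: odd_expsum_cst.
by under eq_fun do rewrite mxE; exact: odd_expsum_cst.
Qed.

Lemma tame_form_comb (b c : nat -> R) (k l : nat -> 'rV[R]_n * R) :
  odd_expsum b -> odd_expsum c -> tame_form k -> tame_form l ->
  tame_form (fun p => b p *: k p - c p *: l p).
Proof.
move=> tb tc [tk1 tk2] [tl1 tl2]; split=> [i|] /=.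
  under eq_fun do rewrite !mxE.
  by apply: odd_expsumD; [|apply: odd_expsum_opp]; exact: odd_expsumM.
by apply: odd_expsumD; [|apply: odd_expsum_opp]; exact: odd_expsumM.
Qed.

Lemma odd_expsum_slack (l : nat -> 'rV[R]_n * R) (a : 'rV[R]_n) : tame_form l ->
  odd_expsum (fun p => slack (l p) (phi p a) 1).
Proof.
move=> [tl1 tl2]; apply: odd_expsumD.
  apply: odd_expsum_sum => i; apply: odd_expsumM => //.
  by under eq_fun do rewrite mxE; exact: odd_expsum_pow.
by apply: odd_expsum_opp; under eq_fun do rewrite mulr1.
Qed.

(** Adding a point [a] to the list eliminates its weight [t].  At stage [p] the sign
    of the coefficient of [t] selects which combinations of inequalities are
    kept; as these signs are eventually constant, the selection can be made
    once for all large [p].  Discarded combinations are replaced by the trivial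
    inequality, so that the index type needs no subtype. *)
Lemma cone_polyhedral (s : seq 'rV[R]_n) :
  exists (J : finType) (l : J -> nat -> 'rV[R]_n * R),
  [/\ (0 < #|J|)%N, forall j, tame_form (l j)
    & \forall p \near \oo, forall y h,
        cone [seq phi p a | a <- s] y h <-> forall j, slack (l j p) y h <= 0].
Proof.
elim: s => [|a s [J [l [J0 tl near_l]]]].
  pose sgn (b : bool) : R := if b then 1 else -1.
  (* The cone of the empty list is the origin: both signs of each coordinate of
     [y] (index [Some i]) and of [h] (index [None]). *)
  exists (bool * option 'I_n)%type, (fun j _ =>
    if j.2 is Some i then (sgn j.1 *: delta_mx 0 i, 0) else (0, sgn j.1)).
  split.
  - by apply/card_gt0P; exists (true, None).
  - move=> [b [i|]]; split => [k|] /=; exact: odd_expsum_cst.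
  - near=> p => y h; split=> [[-> ->] j|le0].
      rewrite /slack mulr0 subr0 big1// => i _.
      by rewrite mxE mulr0.
    have slack_delta b i : slack (sgn b *: delta_mx 0 i, 0) y h = sgn b * y 0 i.
      rewrite /slack /= mul0r subr0 (bigD1 i)//= big1 => [|k ki].
        by rewrite !mxE !eqxx mulr1 addr0.
      by rewrite !mxE (negPf ki) andbF mulr0 mul0r.
    have slack_height b : slack (0, sgn b) y h = - (sgn b * h).
      by rewrite /slack /= big1 ?sub0r// => k _; rewrite mxE mul0r.
    have y_le0 b i : sgn b * y 0 i <= 0.
      by rewrite -slack_delta; exact: (le0 (b, Some i)).
    have h_ge0 b : 0 <= sgn b * h.
      by rewrite -oppr_le0 -slack_height; exact: (le0 (b, None)).
    split.
      apply/rowP => i; rewrite mxE; apply/le_anti.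
      have := y_le0 true i; have := y_le0 false i.
      by rewrite mul1r mulN1r oppr_le0 => -> ->.
    apply/le_anti.
    have := h_ge0 true; have := h_ge0 false.
    by rewrite mul1r mulN1r oppr_ge0 => -> ->.
pose b j p := slack (l j p) (phi p a) 1.
have tb j : odd_expsum (b j) by exact: odd_expsum_slack.
have /choice[sgn near_sgn] : forall j, exists sgn : R,
  \forall p \near \oo, Num.sg (b j p) = sgn by move=> j; exact: odd_expsum_sg.
(* [inl j] keeps the inequalities that bound [t] from above or not at all;
   [inr (j, k)] confronts the lower bound of [j] with the upper bound of [k]. *)
exists (J + J * J)%type, (fun q => match q with
  | inl j => if sgn j <= 0 then l j else fun=> 0
  | inr (j, k) => if (0 < sgn j) && (sgn k < 0)
                  then fun p => b j p *: l k p - b k p *: l j p else fun=> 0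
  end).
split.
- by rewrite card_sum ltn_addr.
- move=> [j|[j k]]; case: ifP => _; try exact: tame_form0; first exact: tl.
  exact: tame_form_comb.
move/filter_forall : near_sgn; apply: filterS2 near_l => p l_cone sgn_b y h /=.
have -> : (exists2 t, 0 <= t &
      cone [seq phi p a | a <- s] (y - t *: phi p a) (h - t)) <->
    exists2 t, 0 <= t & forall j, slack (l j p) y h <= t * b j p.
  split=> -[t t0 st]; exists t => //; last apply/l_cone => j.
    by move: st => /l_cone st j; have := st j; rewrite slackB subr_le0.
  by rewrite slackB subr_le0; exact: st.
rewrite exists_nonneg_multiplier; split=> [[le_j le_jk] [j|[j k]]|le_q].
- by case: ifP => [|_]; [rewrite -sgn_b sgr_le0; exact: le_j|rewrite slack0].
- case: ifP => [|_]; last by rewrite slack0.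
  by rewrite -!sgn_b sgr_gt0 sgr_lt0 slack_comb => /andP[]; exact: le_jk.
- split=> [j bj|j k bj bk].
    by have := le_q (inl j); rewrite -sgn_b sgr_le0 bj.
  by have := le_q (inr (j, k)); rewrite -!sgn_b sgr_gt0 sgr_lt0 bj bk slack_comb.
Unshelve. all: by end_near. Qed.

End FourierMotzkin.

(** * Upper limits and dense open sets *)

Section UpperLimits.
Variable R : realType.

Lemma increasing_seq_cvg (s : nat -> nat) : increasing_seq s -> s @ \oo --> \oo.
Proof.
move=> /increasing_seqP s_incr; have le_s k : (k <= s k)%N.
  by elim: k => // k IH; rewrite (leq_ltn_trans IH)//; exact: s_incr.
by move=> P [N _ NP]; exists N => // k Nk; apply: NP; exact: leq_trans (le_s k).
Qed.

Lemma Ls_approx (T : pseudoMetricType R) (A : nat -> set T) (x : T) :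
  (forall eps : R, 0 < eps ->
    exists2 y, ball x eps y & \forall p \near \oo, A p y) ->
  Ls A x.
Proof.
move=> approx.
have /choice[yN yNP] : forall k, exists yN : T * nat,
    ball x (k.+1%:R^-1 : R) yN.1 /\ forall p, (yN.2 <= p)%N -> A p yN.1.
  move=> k; have [|y xy [N _ NA]] := approx k.+1%:R^-1; first by rewrite invr_gt0.
  by exists (y, N); split=> // p; exact: NA.
(* Summing the thresholds keeps the stages above each of them, and the term [k]
   makes the sequence of stages strictly increasing. *)
pose s k := (\sum_(i < k.+1) (yN i).2 + k)%N.
exists s, (fun k => (yN k).1); split.
- apply/increasing_seqP => k.
  rewrite ltEnat /= /s [in X in (_ < X)%N]big_ord_recr /= addnS ltnS.
  by rewrite leq_add2r leq_addr.
- move=> k; apply: (yNP k).2; rewrite /s big_ord_recr /= -addnA addnCA.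
  exact: leq_addr.
- apply/cvg_ballP => eps eps0; near=> k.
  apply: le_ball (yNP k).1; apply: ltW.
  by near: k; exact: (near_infty_natSinv_lt (PosNum eps0)).
Unshelve. all: by end_near. Qed.

Lemma finite_dense_open (T : topologicalType) (J : finType) (P : set T)
    (D : J -> set T) : (forall j, open (D j)) ->
  (forall j W, open W -> W `<=` P -> W !=set0 -> W `&` D j !=set0) ->
  forall U, open U -> U `<=` P -> U !=set0 ->
  exists2 x, U x & forall j, D j x.
Proof.
move=> D_open D_dense U U_open UP U0.
suff [x [Ux Dx]] : exists x, U x /\ forall j, j \in enum J -> D j x.
  by exists x => // j; apply: Dx; rewrite mem_enum.
elim: (enum J) U U_open UP U0 => [|j r IH] U U_open UP U0.
  by case: U0 => x Ux; exists x.
have [||x [[Ux Djx] Dx]] := IH (U `&` D j) _ _ (D_dense j U U_open UP U0).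
- exact: openI.
- by move=> x [Ux _]; exact: UP.
by exists x; split=> // i; rewrite inE => /predU1P[->//|]; exact: Dx.
Qed.

End UpperLimits.

(** * Strict opposite inequalities are open and dense *)

Section LowerForms.
Variables (R : realType) (n : nat).
Implicit Types (a x v : 'rV[R]_n) (b c : R).

Lemma lower_form_open a b : open [set x | b < lower_form a x].
Proof.
have cvg_term (x : 'rV[R]_n) i :
    {for x, continuous (fun y : 'rV[R]_n => a 0 i * y 0 i)}.
  apply: (@continuousM _ _ (fun=> a 0 i) (fun y : 'rV[R]_n => y 0 i)).
    exact: cst_continuous.
  exact: coord_continuous.
rewrite openE => x /= xb; have x_filter : Filter (nbhs (x : 'rV[R]_n)) := nbhs_filter x.
move: xb => /big_smile_gt[[b0 ba]|[i [ba i0 ia]]].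
  have : \forall y \near x, forall i, b < a 0 i * (y : 'rV[R]_n) 0 i.
    apply: (@filter_forall _ _ _ _ x_filter) => i.
    exact: (cvgr_gt _ (cvg_term x i) _ (ba i)).
  by apply: filterS => y ya; apply/big_smile_gt; left.
have : \forall y \near x, forall k, 0 < a 0 i * (y : 'rV[R]_n) 0 i + a 0 k * y 0 k.
  apply: (@filter_forall _ _ _ _ x_filter) => k.
  apply: (cvgr_gt _ (cvgD (cvg_term x i) (cvg_term x k))).
  by rewrite -ltrBlDl sub0r.
apply: filterS3 (cvgr_gt _ (cvg_term x i) _ ba) (cvgr_gt _ (cvg_term x i) _ i0).
move=> y yb y0 ya; apply/big_smile_gt; right; exists i; split=> // k.
by rewrite -subr_gt0 opprK addrC.
Qed.

(** Write [m] for [lower_form a x].  If [m > 0], no term exceeds [m], and shrinking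
    [x] brings all of them strictly below [c].  If [m <= 0], some term [i] with
    [a_i != 0] equals [m = - |m|], the largest absolute value; decreasing it
    makes it the unique dominant term, strictly below [c]. *)
Lemma lower_form_perturb a x c : a != 0 -> lower_form a x <= c ->
  exists v, \forall t \near 0^'+, - c < lower_form (- a) (x - t *: v).
Proof.
move=> a0; have [le_m ex_m _] :=
  big_smileP (index_enum 'I_n) (fun i => a 0 i * x 0 i).
rewrite /lower_form; set m := \big[_/_]_i _ in le_m ex_m * => mc.
have {}le_m i : `|a 0 i * x 0 i| <= `|m| by rewrite le_m// mem_index_enum.
have [m0|m0] := ltP 0 m.
  have c0 : 0 < c by exact: lt_le_trans mc.
  exists x; near=> t; apply/big_smile_gt; left; split=> [|k]; first by rewrite oppr_lt0.
  have t0 : 0 < t by near: t; exact: nbhs_right_gt.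
  have t1 : t < 1 by near: t; exact: nbhs_right_lt.
  rewrite !mxE mulNr ltrN2.
  have -> : a 0 k * (x 0 k - t * x 0 k) = (1 - t) * (a 0 k * x 0 k) by ring.
  have := le_m k; rewrite (gtr0_norm m0) ler_norml => /andP[_ km].
  apply: (@le_lt_trans _ _ ((1 - t) * m)); last by nra.
  by rewrite ler_pM2l// subr_gt0.
have [i ai im] : exists2 i, a 0 i != 0 & a 0 i * x 0 i = m.
  have [m_eq0|m_neq0] := eqVneq m 0.
    have /rV0Pn[i ai] := a0; exists i => //; have := le_m i.
    by rewrite m_eq0 normr0 normr_le0 => /eqP.
  have [i _ im] := ex_m m_neq0; exists i => //; apply: contra_neq m_neq0 => ai0.
  by rewrite -im ai0 mul0r.
exists (a 0 i *: delta_mx 0 i); near=> t; apply/big_smile_gt; right; exists i.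
have t0 : 0 < t by near: t; exact: nbhs_right_gt.
have ta0 : 0 < t * a 0 i ^+ 2 by rewrite mulr_gt0// exprn_even_gt0.
have termE k : (- a) 0 k * (x - t *: (a 0 i *: delta_mx 0 i)) 0 k =
    - (a 0 k * x 0 k) + (if k == i then t * a 0 i ^+ 2 else 0).
  rewrite !mxE eqxx /=; case: eqVneq => [->|_] /=; ring.
rewrite !termE eqxx im; split; [lra|lra|move=> k].
rewrite termE; have := le_m k; rewrite (ler0_norm m0) ler_norml => /andP[_ kM].
by case: ifP => _; lra.
Unshelve. all: by end_near. Qed.

Lemma subr_scale_cvg x v : (fun t : R => x - t *: v) @ (0 : R)^'+ --> x.
Proof.
have : (fun t : R => x - t *: v) @ 0 --> x - 0 *: v.
  by apply: cvgB; [exact: cvg_cst|apply: cvgZr_tmp; exact: cvg_id].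
by rewrite scale0r subr0; exact: cvg_at_right_filter.
Qed.

Lemma lower_form_strict_dense a c (W : set 'rV[R]_n) : a != 0 ->
  open W -> W `<=` [set x | lower_form a x <= c] -> W !=set0 ->
  W `&` [set x | - c < lower_form (- a) x] !=set0.
Proof.
move=> a0 W_open Wc [x Wx]; have [v near_v] := lower_form_perturb a0 (Wc _ Wx).
have near_W : \forall t \near (0 : R)^'+, W (x - t *: v).
  by apply: subr_scale_cvg; exact: open_nbhs_nbhs.
have [t [Wt ct]] := @filter_ex _ _ _ _ (filterI near_W near_v).
by exists (x - t *: v).
Qed.

End LowerForms.

(** * Limits of half-spaces *)

Section LimitHalfspaces.
Variables (R : realType) (n : nat).
Implicit Types (a x : 'rV[R]_n) (c : R).

(** If the lower form exceeded [c], choose [b] strictly between: by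
    [odd_pow_sum_gt] the left-hand side is eventually above [b ^ N], while the
    right-hand side is eventually below it. *)
Lemma lower_form_limit_le (w : 'I_n -> nat -> R) (g : nat -> R) a c
    (e : nat -> nat) (y : nat -> 'rV[R]_n) x :
  (forall i, w i @ \oo --> a 0 i) -> g @ \oo --> c ->
  e @ \oo --> \oo -> y @ \oo --> x ->
  (\forall k \near \oo, \sum_i w i (e k) ^+ (2 * e k).+1 * y k 0 i ^+ (2 * e k).+1
     <= g (e k) ^+ (2 * e k).+1) ->
  lower_form a x <= c.
Proof.
move=> wa gc eoo yx near_le; rewrite leNgt; apply/negP => c_lt.
pose b := (c + lower_form a x) / 2.
have cb : c < b by rewrite /b; lra.
have b_lt : b < lower_form a x by rewrite /b; lra.
have term_cvg i : (fun k => w i (e k) * y k 0 i) @ \oo --> a 0 i * x 0 i.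
  apply: cvgM; first exact: (cvg_comp e (w i) eoo (wa i)).
  exact: (cvg_comp y (fun z : 'rV[R]_n => z 0 i) yx (@coord_continuous _ _ _ 0 i x)).
have gb : \forall k \near \oo, g (e k) < b.
  exact: (cvgr_lt _ (cvg_comp e g eoo gc) _ cb).
have [k [[le_k lt_k] gb_k]] :=
  @filter_ex _ _ _ _ (filterI (filterI near_le (odd_pow_sum_gt eoo term_cvg b_lt)) gb).
have : b ^+ (2 * e k).+1 < g (e k) ^+ (2 * e k).+1.
  apply: lt_le_trans lt_k (le_trans _ le_k).
  by under eq_bigr do rewrite exprMn.
by rewrite ltr_odd_exp /= ?oddM// => /lt_trans/(_ gb_k); rewrite ltxx.
Qed.

(** [odd_pow_sum_gt] applied to the opposite terms, with a level [b] strictly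
    between [- c] and [lower_form (- a) x]. *)
Lemma lower_form_strict_halfspace (w : 'I_n -> nat -> R) (g : nat -> R) a c x :
  (forall i, w i @ \oo --> a 0 i) -> g @ \oo --> c -> - c < lower_form (- a) x ->
  \forall p \near \oo,
    \sum_i w i p ^+ (2 * p).+1 * x 0 i ^+ (2 * p).+1 <= g p ^+ (2 * p).+1.
Proof.
move=> wa gc c_lt; pose b := (- c + lower_form (- a) x) / 2.
have cb : - c < b by rewrite /b; lra.
have b_lt : b < lower_form (- a) x by rewrite /b; lra.
have term_cvg i : (fun p => - w i p * x 0 i) @ \oo --> (- a) 0 i * x 0 i.
  by rewrite mxE; apply: cvgM; [exact: cvgN|exact: cvg_cst].
have gb : \forall p \near \oo, - b < g p by apply: (cvgr_gt _ gc); rewrite ltrNl.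
apply: filterS2 gb (odd_pow_sum_gt (@cvg_id _ \oo) term_cvg b_lt) => p gb.
have odd_p : odd (2 * p).+1 by rewrite /= oddM.
under eq_bigr do rewrite exprMn odd_expN// mulNr.
rewrite sumrN ltrNr -odd_expN// => /ltW/le_trans; apply; apply: ltW.
by rewrite ltr_odd_exp.
Qed.

End LimitHalfspaces.

(** * Half-spaces describing the upper limit of the hulls *)

Lemma Cop_cone (R : realType) (n p : nat) (s : seq 'rV[R]_n) (x : 'rV[R]_n) :
  Cop p [set` s] x <-> cone [seq phi p a | a <- s] (phi p x) 1.
Proof.
rewrite -cone_convex_hull /Cop /Co /=.
suff -> : phi p @` [set` s] = [set` [seq phi p a | a <- s]] by [].
by apply/seteqP; split=> [y [a /= sa <-]|y /= /mapP[a sa ->]]; [exact: map_f|exists a].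
Qed.

Theorem proposition4p2p6 (R : realType) (n : nat) (A : set 'rV[R]_n) :
  finite_set A ->
  exists (l : nat) (f : 'I_l -> 'rV[R]_n -> R) (c : 'I_l -> R),
    [/\ (0 < l)%N,
        forall j, is_lower_form (f j),
        interior (\bigcap_j [set x | f j x <= c j]) `<=` Coinfty A,
        Coinfty A `<=` \bigcap_j [set x | f j x <= c j]
      & regclosed (\bigcap_j [set x | f j x <= c j]) ->
        Coinfty A = \bigcap_j [set x | f j x <= c j]].
Proof.
move=> /finite_seqP[s ->]; have [J [l [J0 tame_l near_l]]] := cone_polyhedral s.
have /choice[a0 /choice[w wP]] : forall ji : J * 'I_n, exists a (w : nat -> R),
    [/\ w @ \oo --> a, forall p, (l ji.1 p).1 0 ji.2 = w p ^+ (2 * p).+1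
      & a = 0 -> (fun p => (l ji.1 p).1 0 ji.2) = fun=> 0].
  by move=> [j i]; apply: odd_expsum_root; exact: (tame_l j).1.
have /choice[c /choice[g gP]] : forall j, exists c (g : nat -> R),
    [/\ g @ \oo --> c, forall p, (l j p).2 = g p ^+ (2 * p).+1
      & c = 0 -> (fun p => (l j p).2) = fun=> 0].
  by move=> j; apply: odd_expsum_root; exact: (tame_l j).2.
pose a j : 'rV[R]_n := \row_i a0 (j, i).
have wa j i : w (j, i) @ \oo --> a j 0 i by rewrite mxE; case: (wP (j, i)).
have gc j : g j @ \oo --> c j by case: (gP j).
have wE j i p : (l j p).1 0 i = w (j, i) p ^+ (2 * p).+1.
  by case: (wP (j, i)) => _ ->.
have gE j p : (l j p).2 = g j p ^+ (2 * p).+1 by case: (gP j).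
have near_Cop : \forall p \near \oo, forall x, Cop p [set` s] x <-> forall j,
    \sum_i w (j, i) p ^+ (2 * p).+1 * x 0 i ^+ (2 * p).+1 <= g j p ^+ (2 * p).+1.
  apply: filterS near_l => p l_cone x; rewrite Cop_cone l_cone.
  have slackE j : slack (l j p) (phi p x) 1 =
      \sum_i w (j, i) p ^+ (2 * p).+1 * x 0 i ^+ (2 * p).+1 - g j p ^+ (2 * p).+1.
    by rewrite /slack mulr1 gE; under eq_bigr do rewrite mxE wE.
  by split=> le_j j; have := le_j j; rewrite slackE subr_le0.
pose P := [set x : 'rV[R]_n | forall j, lower_form (a j) x <= c j].
exists #|J|, (fun q => lower_form (a (enum_val q))), (fun q => c (enum_val q)).
have -> : \bigcap_(q : 'I_#|J|)
    [set x | lower_form (a (enum_val q)) x <= c (enum_val q)] = P.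
  apply/seteqP; split=> x xP; last by move=> q _; exact: xP.
  by move=> j; have := xP (enum_rank j) I; rewrite /= enum_rankK.
have outer : Coinfty [set` s] `<=` P.
  move=> x [e [y [/increasing_seq_cvg eoo yC yx]]] j.
  apply: (lower_form_limit_le (wa j) (gc j) eoo yx).
  have : \forall k \near \oo, forall z, Cop (e k) [set` s] z <-> forall j,
      \sum_i w (j, i) (e k) ^+ (2 * e k).+1 * z 0 i ^+ (2 * e k).+1
        <= g j (e k) ^+ (2 * e k).+1 by exact: eoo _ near_Cop.
  by apply: filterS => k CopE; exact: (CopE _).1.
have inner : closure (interior P) `<=` Coinfty [set` s].
  move=> x Px; apply: Ls_approx => eps eps0.
  pose D j := if a j == 0 then setT else [set y | - c j < lower_form (- a j) y].
  have D_open j : open (D j).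
    by rewrite /D; case: ifP => _; [exact: openT|exact: lower_form_open].
  have D_dense j W : open W -> W `<=` P -> W !=set0 -> W `&` D j !=set0.
    move=> W_open WP W0; rewrite /D; case: eqVneq => [_|aj0].
      by rewrite setIT.
    by apply: lower_form_strict_dense => // y /WP; exact.
  pose U := interior P `&` interior (ball x eps).
  have U0 : U !=set0.
    have [z [Pz xz]] := Px _ (nbhs_interior (nbhsx_ballx x _ eps0)).
    by exists z.
  have [||y [Py xy] Dy] := finite_dense_open D_open D_dense _ _ U0.
  - by apply: openI; exact: open_interior.
  - by move=> y [Py _]; exact: (interior_subset Py).
  exists y; first exact: interior_subset.
  have : forall j, \forall p \near \oo,
      \sum_i w (j, i) p ^+ (2 * p).+1 * y 0 i ^+ (2 * p).+1 <= g j p ^+ (2 * p).+1.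
    move=> j; have := Dy j; rewrite /D; case: eqVneq => [aj0 _|_ /=]; last first.
      exact: lower_form_strict_halfspace.
    (* A zero limit form comes from coefficients that vanish identically, so only
       the sign of [gamma] matters. *)
    have w0 i p : w (j, i) p ^+ (2 * p).+1 = 0.
      have [_ <- /(_ _)/(congr1 (@^~ p))] := wP (j, i); apply.
      by have := congr1 (fun r : 'rV[R]_n => r 0 i) aj0; rewrite !mxE.
    suff : \forall p \near \oo, 0 <= g j p ^+ (2 * p).+1.
      by apply: filterS => p; rewrite big1// => i _; rewrite w0 mul0r.
    have c_ge0 : 0 <= c j.
      rewrite leNgt; apply/negP => c_lt0; have := interior_subset Py j.
      rewrite leNgt => /negP; apply; apply/big_smile_gt; left; split=> // i.
      by rewrite aj0 mxE mul0r.
    have [c_eq0|c_neq0] := eqVneq (c j) 0.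
      have [_ _ /(_ c_eq0) g0] := gP j; near=> p.
      by rewrite -gE (congr1 (@^~ p) g0).
    near=> p; rewrite exprn_ge0// ltW//; near: p.
    by apply: (cvgr_gt _ (gc j)); rewrite lt_neqAle eq_sym c_neq0.
  by move/filter_forall; apply: filterS2 near_Cop => p CopE /CopE.
split=> //.
- by move=> q; exists (a (enum_val q)).
- by apply: subset_trans inner; exact: subset_closure.
- move=> P_reg; apply/seteqP; split=> //.
  by rewrite -[X in X `<=` _]P_reg.
Unshelve. all: by end_near. Qed.
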